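(* Let $\mathbb F$ be a field, let $R(s)\in\mathbb F(s)^{m\times n}$ be a rational matrix with $\operatorname{rank}(R(s))=r$, and let $\tilde p_1\le\dots\le\tilde p_r$ be its invariant orders at $\infty$. Let $z,x$ be integers such that $0\le x\le\min\{z,n-r\}$ and let $\tilde q_1\le\dots\le\tilde q_{r+x}$ be integers. There exists a rational matrix $\widetilde W(s)\in\mathbb F(s)^{z\times n}$ such that $\operatorname{rank}\begin{bmatrix}R(s)\\\widetilde W(s)\end{bmatrix}=r+x$ and $\begin{bmatrix}R(s)\\\widetilde W(s)\end{bmatrix}$ has $\tilde q_1,\dots,\tilde q_{r+x}$ as invariant orders at $\infty$ if and only if $$\tilde q_i\le\tilde p_i\le\tilde q_{i+z},\quad 1\le i\le r.$$
   Context: $\mathbb F$ is an arbitrary field, $\mathbb F(s)$ the field of rational functions, and $\mathbb F_{pr}(s)$ the ring of proper rational functions (degree of denominator at least degree of numerator). A square matrix over $\mathbb F_{pr}(s)$ is biproper if it is invertible over $\mathbb F_{pr}(s)$. The invariant orders at infinity of a rational matrix $R(s)\in\mathbb F(s)^{m\times n}$ of rank $r$ are the unique integers $\tilde p_1\le\dots\le\tilde p_r$ such that $B_1(s)R(s)B_2(s)=\begin{bmatrix}\operatorname{diag}(s^{-\tilde p_1},\dots,s^{-\tilde p_r})&0\\0&0\end{bmatrix}$ for some biproper $B_1(s),B_2(s)$. Convention: for an increasing sequence $b_1\le\dots\le b_k$, $b_i=-\infty$ for $i<1$ and $b_i=+\infty$ for $i>k$ (so $\tilde q_{i+z}=+\infty$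 if $i+z>r+x$). *)

(* Defs.v *)
From HB Require Import structures.
From mathcomp Require Import all_boot all_order all_algebra.
From mathcomp Require Import constructive_ereal.

Set Implicit Arguments.
Unset Strict Implicit.
Unset Printing Implicit Defensive.

Import Order.TTheory GRing.Theory Num.Theory.
Local Open Scope ring_scope.

Notation ratfun F := {fraction {poly F}}.

Section RationalMatrices.

Variable F : fieldType.

Definition ratvar : ratfun F := tofrac ('X : {poly F}).

(* [size] is degree + 1, and [size 0 = 0], so 0 is proper. *)
Definition proper (f : ratfun F) : Prop :=
  exists a b : {poly F},
    [/\ b != 0, (size a <= size b)%N & f = tofrac a / tofrac b].

Definition proper_mx m n (A : 'M[ratfun F]_(m, n)) : Prop :=
  forall i j, proper (A i j).

Definition biproper k (B : 'M[ratfun F]_k) : Prop :=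
  proper_mx B /\
  exists B' : 'M[ratfun F]_k,
    [/\ proper_mx B', B *m B' = 1%:M & B' *m B = 1%:M].

Definition infty_diag_mx m n (p : seq int) : 'M[ratfun F]_(m, n) :=
  \matrix_(i < m, j < n)
    if (i == j :> nat) && (i < size p)%N then ratvar ^ (- p`_i) else 0.

Definition invariant_orders_at_infty m n (R : 'M[ratfun F]_(m, n))
    (p : seq int) : Prop :=
  [/\ size p = \rank R,
      sorted <=%R p &
      exists (B1 : 'M[ratfun F]_m) (B2 : 'M[ratfun F]_n),
        [/\ biproper B1, biproper B2 &
            B1 *m R *m B2 = infty_diag_mx m n p]].

End RationalMatrices.

(* The term of 1-based index i of b = b_1, ..., b_k, extended by -oo for
   i < 1 and by +oo for i > k. *)
Definition ext_nth (b : seq int) (i : nat) : \bar int :=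
  if (i < 1)%N then -oo%E
  else if (i <= size b)%N then (b`_i.-1)%:E
  else +oo%E.

(* Main.v *)
(** Write D_p for the diagonal matrix with entries s^(-p_i).  The invariant orders
    behave like singular values: the number of orders below c is the least rank of
    a matrix N such that s^c (R - N) is proper.  Truncating an approximation of
    [R; W] gives one of R of no larger rank, and appending W to an approximation of
    R raises the rank by at most z; this gives both inequalities.  Conversely,
    D_p can be completed by z explicit rows, using unitriangular matrices whose
    proper entries s^(p_i - q_(i+z)) and s^(q_i - p_i) encode the inequalities. *)

From mathcomp Require Import all_boot all_order all_fingroup all_algebra.
From mathcomp Require Import constructive_ereal.
From mathcomp Require Import zify ring.
Require Import Defs.

Set Implicit Arguments.
Unset Strict Implicit.
Unset Printing Implicit Defensive.

Import Order.TTheory GRing.Theory Num.Theory.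
Local Open Scope ring_scope.

(** * Proper rational functions, proper and biproper matrices *)

Section ProperFunctions.

Variable F : fieldType.
Implicit Types f g : ratfun F.

Lemma ratvar_neq0 : ratvar F != 0.
Proof. by rewrite tofrac_eq0 polyX_eq0. Qed.

Lemma ratvar_expD (a b : int) : ratvar F ^ (a + b) = ratvar F ^ a * ratvar F ^ b.
Proof. exact/expfzDr/ratvar_neq0. Qed.

Lemma properN f : proper f -> proper (- f).
Proof.
case=> a [b [b0 ab ->]]; exists (- a), b; split => //; first by rewrite size_polyN.
by rewrite tofracN mulNr.
Qed.

Lemma properM f g : proper f -> proper g -> proper (f * g).
Proof.
case=> a [b [b0 ab ->]] [c [d [d0 cd ->]]]; exists (a * c), (b * d).
split; first by rewrite mulf_neq0.
  apply: leq_trans (size_polyMleq _ _) _.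
  by rewrite (size_mul b0 d0) -!subn1 leq_sub2r ?leq_add.
by rewrite !tofracM mulf_div.
Qed.

Lemma properD f g : proper f -> proper g -> proper (f + g).
Proof.
case=> a [b [b0 ab ->]] [c [d [d0 cd ->]]]; exists (a * d + b * c), (b * d).
split; first by rewrite mulf_neq0.
  rewrite (size_mul b0 d0); apply: leq_trans (size_polyD _ _) _; rewrite geq_max.
  rewrite !(leq_trans (size_polyMleq _ _)) // -!subn1 leq_sub2r ?leq_add //.
by rewrite tofracD !tofracM addf_div ?tofrac_eq0 // (mulrC (tofrac c)).
Qed.

Lemma proper0 : proper (0 : ratfun F).
Proof. by exists 0, 1; split; rewrite ?oner_eq0 ?size_poly0 // tofrac0 mul0r. Qed.

Lemma proper1 : proper (1 : ratfun F).
Proof. by exists 1, 1; split; rewrite ?oner_eq0 // tofrac1 divr1. Qed.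

Lemma proper_sum (I : finType) (P : pred I) (G : I -> ratfun F) :
  (forall i, P i -> proper (G i)) -> proper (\sum_(i | P i) G i).
Proof. by move=> PG; apply: big_ind => //; [exact: proper0 | exact: properD]. Qed.

Lemma proper_prod (I : finType) (P : pred I) (G : I -> ratfun F) :
  (forall i, P i -> proper (G i)) -> proper (\prod_(i | P i) G i).
Proof. by move=> PG; apply: big_ind => //; [exact: proper1 | exact: properM]. Qed.

Lemma proper_sign (b : bool) : proper ((-1) ^+ b : ratfun F).
Proof. by case: b; [apply: properN |]; exact: proper1. Qed.

Lemma proper_ratvar_exp (c : int) : c <= 0 -> proper (ratvar F ^ c).
Proof.
case: c => [[|c]|c] // _; first exact: proper1.
exists 1, 'X^(c.+1); split; first by rewrite monic_neq0 ?monicXn.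
  by rewrite size_poly1 size_polyXn.
by rewrite tofrac1 div1r tofracXn.
Qed.

Lemma ratvar_not_proper : ~ proper (ratvar F).
Proof.
case=> a [b [b0 ab /(congr1 ( *%R^~ (tofrac b)))]].
rewrite divfK ?tofrac_eq0 // /ratvar -tofracM => /eqP; rewrite tofrac_eq => /eqP E.
by move: ab; rewrite -E mulrC size_mulX // ltnn.
Qed.

Lemma proper_mxM m n k (A : 'M[ratfun F]_(m, n)) (B : 'M_(n, k)) :
  proper_mx A -> proper_mx B -> proper_mx (A *m B).
Proof. by move=> PA PB i j; rewrite mxE; apply: proper_sum => l _; exact: properM. Qed.

Lemma proper_det k (A : 'M[ratfun F]_k) : proper_mx A -> proper (\det A).
Proof.
move=> PA; apply: proper_sum => s _; apply: properM; first exact: proper_sign.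
exact: proper_prod.
Qed.

Lemma proper_mx1 k : proper_mx (1%:M : 'M[ratfun F]_k).
Proof. by move=> i j; rewrite mxE; case: (i == j); [exact: proper1 | exact: proper0]. Qed.

Lemma proper_block_mx m1 m2 n1 n2 (A : 'M[ratfun F]_(m1, n1)) (B : 'M_(m1, n2))
    (C : 'M_(m2, n1)) (D : 'M_(m2, n2)) :
  proper_mx A -> proper_mx B -> proper_mx C -> proper_mx D ->
  proper_mx (block_mx A B C D).
Proof.
move=> PA PB PC PD i j; rewrite /block_mx mxE.
by case: splitP => i' _; rewrite mxE; case: splitP.
Qed.

Lemma biproper_mxM k (A B : 'M[ratfun F]_k) :
  biproper A -> biproper B -> biproper (A *m B).
Proof.
case=> PA [A' [PA' AA' A'A]] [PB [B' [PB' BB' B'B]]].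
split; first exact: proper_mxM.
exists (B' *m A'); split; first exact: proper_mxM.
  by rewrite mulmxA -(mulmxA A) BB' mulmx1.
by rewrite mulmxA -(mulmxA B') A'A mulmx1.
Qed.

Lemma biproper_mx1 k : biproper (1%:M : 'M[ratfun F]_k).
Proof.
split; first exact: proper_mx1.
by exists 1%:M; split; rewrite ?mulmx1 //; exact: proper_mx1.
Qed.

Lemma biproper_inv k (A : 'M[ratfun F]_k) :
  biproper A -> [/\ A \in unitmx, biproper A & biproper (invmx A)].
Proof.
move=> [PA [A' [PA' AA' A'A]]]; have [uA _] := mulmx1_unit AA'.
have <- : A' = invmx A by rewrite -[LHS](mulKmx uA) AA' mulmx1.
by split=> //; split=> //; [exists A' | exists A].
Qed.

(** The inverse is the sign times the adjugate, whose entries are signed minors of a proper matrix.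
    Allowing the sign covers row permutations of unitriangular matrices. *)
Lemma biproper_det k (A : 'M[ratfun F]_k) (b : bool) :
  proper_mx A -> \det A = (-1) ^+ b -> biproper A.
Proof.
move=> PA dA; have uA : A \in unitmx by rewrite unitmxE dA unitrX ?unitrN ?unitr1.
split=> //; exists (invmx A); split; rewrite ?mulmxV ?mulVmx // /invmx uA.
move=> i j; rewrite !mxE dA invr_sign; apply: properM; first exact: proper_sign.
apply: properM; first by rewrite -signr_odd; exact: proper_sign.
by apply: proper_det => k1 k2; rewrite !mxE.
Qed.

Lemma biproper_block k l (A : 'M[ratfun F]_k) :
  biproper A -> biproper (block_mx A 0 0 (1%:M : 'M_l)).
Proof.
have P0 i j : proper_mx (0 : 'M[ratfun F]_(i, j)) by move=> ? ?; rewrite mxE; exact: proper0.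
case=> PA [A' [PA' AA' A'A]].
split; first by apply: proper_block_mx => //; exact: proper_mx1.
exists (block_mx A' 0 0 1%:M); split.
- by apply: proper_block_mx => //; exact: proper_mx1.
- by rewrite mulmx_block !mulmx0 !mul0mx !addr0 mulmx1 add0r AA' -scalar_mx_block.
- by rewrite mulmx_block !mulmx0 !mul0mx !addr0 mulmx1 add0r A'A -scalar_mx_block.
Qed.

(* Modulo strictly proper functions, the determinant is that of the identity. *)
Lemma det_perturbation_neq0 k (E : 'M[ratfun F]_k) :
  proper_mx (ratvar F *: E) -> \det (1%:M - E) != 0.
Proof.
(* [sp] expresses strict properness; such functions form an ideal of the ring of proper
   functions. *)
move=> PE; pose sp f := proper (ratvar F * f).
have s0 := ratvar_neq0.
have PE' i j : sp (E i j) by have := PE i j; rewrite mxE.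
have sp_proper f : sp f -> proper f.
  move=> Pf; rewrite -(mulKf s0 f); apply: properM => //.
  exact: (@proper_ratvar_exp (-1)).
have spM f g : sp f -> proper g -> sp (f * g).
  by move=> Pf Pg; rewrite /sp mulrA; exact: properM.
have spD f g : sp f -> sp g -> sp (f + g).
  by move=> Pf Pg; rewrite /sp mulrDr; exact: properD.
have spN f : sp f -> sp (- f) by rewrite /sp mulrN; exact: properN.
have sp0 : sp 0 by rewrite /sp mulr0; exact: proper0.
have PA i j : proper ((1%:M - E) i j).
  by rewrite mxE; apply: properD; [exact: proper_mx1 | rewrite mxE; apply/properN/sp_proper].
(* A zero determinant would make [-1] strictly proper, hence [s] itself proper. *)
suff : sp (\det (1%:M - E) - 1).
  move=> spd; apply/eqP => d0; move: spd; rewrite d0 sub0r => /spN.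
  by rewrite opprK /sp mulr1; exact: ratvar_not_proper.
(* In the Leibniz expansion the identity permutation contributes a product of factors congruent to
   1. Any other permutation moves some [i], which supplies a strictly proper off-diagonal factor. *)
rewrite /determinant (bigD1 (1%g : {perm 'I_k})) //= addrAC; apply: (spD).
  rewrite odd_perm1 mul1r.
  apply: (big_ind (fun f => sp (f - 1))) => [|f g Pf Pg|i _]; first by rewrite subrr.
    have -> : f * g - 1 = (f - 1) * ((g - 1) + 1) + (g - 1) by ring.
    apply: (spD) => //; apply: (spM) => //; apply: properD; [exact: sp_proper|exact: proper1].
  by rewrite perm1 !mxE eqxx mulr1n addrAC subrr add0r; exact: spN.
apply: (big_ind sp) => // s s1.
have [i si] : exists i, s i != i.
  apply/existsP; apply: contraNT s1 => /existsPn s1; apply/eqP/permP => i.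
  by rewrite perm1; apply/eqP; have := s1 i; rewrite negbK.
rewrite mulrC (bigD1 i) //= -mulrA; apply: spM.
  by rewrite !mxE eq_sym (negPf si) sub0r; exact: spN.
by apply: properM; [exact: proper_prod | exact: proper_sign].
Qed.

End ProperFunctions.

Lemma sum_ord_delta (V : nmodType) n (i : nat) (g : nat -> V) :
  \sum_(k < n) (if i == k then g k else 0) = if (i < n)%N then g i else 0.
Proof.
rewrite -big_mkcond; case: ltnP => ni; last first.
  by rewrite big1 // => k /eqP ik; move: ni; rewrite ik leqNgt ltn_ord.
by rewrite (big_pred1 (Ordinal ni)) // => k; rewrite eq_sym.
Qed.

(** * Rectangular diagonal matrices *)

Section RectangularDiagonal.

Variable K : fieldType.

Lemma mxrank_mul_unit m n (A : 'M[K]_m) (M : 'M[K]_(m, n)) (B : 'M[K]_n) :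
  A \in unitmx -> B \in unitmx -> \rank (A *m M *m B) = \rank M.
Proof.
rewrite -row_full_unit -row_free_unit => uA uB.
by rewrite (mxrankMfree _ uB) (eqmxMfull _ uA).
Qed.

(** Indexing the diagonal by [nat] lets one [f] serve all shapes, so that truncations and coordinate
    projections are again of this form. *)
Definition dmx m n (f : nat -> K) : 'M[K]_(m, n) :=
  \matrix_(i < m, j < n) if i == j :> nat then f i else 0.

Lemma mul_dmx m n k (f : nat -> K) (g : nat -> nat -> K) :
  dmx m n f *m (\matrix_(i < n, j < k) g i j) =
  \matrix_(i < m, j < k) if (i < n)%N then f i * g i j else 0.
Proof.
apply/matrixP => i j; rewrite !mxE -(sum_ord_delta n i (fun l => f i * g l j)).
by apply: eq_bigr => l _; rewrite !mxE; case: eqP; rewrite ?mul0r.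
Qed.

Lemma mul_mx_dmx m n k (f : nat -> K) (g : nat -> nat -> K) :
  (\matrix_(i < m, j < n) g i j) *m dmx n k f =
  \matrix_(i < m, j < k) if (j < n)%N then g i j * f j else 0.
Proof.
apply/matrixP => i j; rewrite !mxE -(sum_ord_delta n j (fun l => g i l * f l)).
by apply: eq_bigr => l _; rewrite !mxE eq_sym; case: eqP; rewrite ?mulr0.
Qed.

Lemma dmx_mul m n k (f g : nat -> K) :
  dmx m n f *m dmx n k g = dmx m k (fun i => if (i < n)%N then f i * g i else 0).
Proof.
rewrite [dmx n k g]/dmx (mul_dmx m n k f (fun i j => if i == j then g i else 0)).
by apply/matrixP => i j; rewrite !mxE; case: eqP; rewrite ?mulr0 ?if_same.
Qed.

Lemma dmx_id k (f : nat -> K) :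
  (forall i, (i < k)%N -> f i = 1) -> dmx k k f = 1%:M.
Proof.
move=> f1; apply/matrixP => i j; rewrite !mxE -val_eqE f1 //.
by case: eqP.
Qed.

Lemma rank_dmx_le m n k (f : nat -> K) :
  (forall i, (k <= i)%N -> f i = 0) -> (\rank (dmx m n f) <= k)%N.
Proof.
move=> f0; suff -> : dmx m n f = dmx m k (fun=> 1) *m dmx k n f by exact: mulmx_max_rank.
rewrite dmx_mul; apply/matrixP => i j; rewrite !mxE mul1r.
by case: eqP => // _; case: ltnP => // /f0.
Qed.

End RectangularDiagonal.

(** * Invariant orders at infinity: approximation, interlacing, completion *)

Section InvariantOrders.

Variable F : fieldType.
Local Notation s := (ratvar F).
Implicit Types p q : seq int.

Definition order_entry p (i : nat) : ratfun F :=
  if (i < size p)%N then s ^ (- p`_i) else 0.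

Lemma infty_diag_dmx m n p : infty_diag_mx F m n p = dmx m n (order_entry p).
Proof.
by apply/matrixP => i j; rewrite !mxE /order_entry; case: eqP.
Qed.

Lemma proper_dmx m n (f : nat -> ratfun F) :
  (forall i, (i < m)%N -> (i < n)%N -> proper (f i)) -> proper_mx (dmx m n f).
Proof.
move=> Pf i j; rewrite mxE; case: eqP => ij; last exact: proper0.
by apply: Pf; rewrite // ij.
Qed.

Lemma dmx_scale m n (a : ratfun F) (f : nat -> ratfun F) :
  a *: dmx m n f = dmx m n (fun i => a * f i).
Proof. by apply/matrixP => i j; rewrite !mxE; case: eqP; rewrite ?mulr0. Qed.

Lemma rank_infty_diag m n p : (size p <= m)%N -> (size p <= n)%N ->
  \rank (infty_diag_mx F m n p) = size p.
Proof.
move=> pm pn; rewrite infty_diag_dmx; apply/eqP; rewrite eqn_leq; apply/andP; split.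
  by apply: rank_dmx_le => i; rewrite /order_entry leqNgt => /negPf ->.
(* Factoring an identity matrix of size [size p] through the diagonal matrix bounds its rank from
   below. *)
have e : dmx (size p) m (fun i => s ^ p`_i) *m dmx m n (order_entry p)
    *m dmx n (size p) (fun=> 1) = 1%:M.
  rewrite !dmx_mul; apply: dmx_id => i ip.
  rewrite /order_entry ip (leq_trans ip pm) (leq_trans ip pn) mulr1 -ratvar_expD.
  by rewrite subrr expr0z.
rewrite -[leqLHS](mxrank1 (ratfun F)) -e.
by rewrite (leq_trans (mxrankM_maxl _ _)) // mxrankM_maxr.
Qed.

(** Keep only the first [i] diagonal entries of the reduced form. Since [p] is sorted, every entry
    [s ^ (- p_j)] left in the error has [j >= i], and multiplication by [s ^ p_i] makes it
    proper. *)
Lemma low_rank_approximation m n (M : 'M[ratfun F]_(m, n)) p i :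
  invariant_orders_at_infty M p -> (i < size p)%N ->
  exists2 N : 'M_(m, n), (\rank N <= i)%N & proper_mx (s ^ p`_i *: (M - N)).
Proof.
case=> _ sp [B1 [B2 [/biproper_inv [u1 _ b1] /biproper_inv [u2 _ b2] e]]] ip.
have -> : M = invmx B1 *m dmx m n (order_entry p) *m invmx B2.
  by rewrite -infty_diag_dmx -e mulmxA (mulmxK u2) (mulKmx u1).
exists (invmx B1 *m dmx m n (order_entry (take i p)) *m invmx B2).
  rewrite (leq_trans (mxrankM_maxl _ _)) // (leq_trans (mxrankM_maxr _ _)) //.
  by apply: rank_dmx_le => j ij; rewrite /order_entry size_take ip ltnNge ij.
rewrite -mulmxBl -mulmxBr scalemxAl scalemxAr.
apply: proper_mxM (proj1 b2); apply: proper_mxM (proj1 b1) _.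
move=> j k; rewrite !mxE; case: eqP => _; last by rewrite subrr mulr0; exact: proper0.
rewrite /order_entry size_take ip; case: (ltnP j i) => ji.
  by rewrite (ltn_trans ji ip) nth_take // subrr mulr0; exact: proper0.
rewrite subr0; case: ifP => jp; last by rewrite mulr0; exact: proper0.
rewrite -ratvar_expD; apply: proper_ratvar_exp; rewrite subr_le0.
by apply: (sorted_leq_nth le_trans lexx 0 sp).
Qed.

(** This is the optimality counterpart of truncation: the leading block of size [i + 1], normalised
    to the identity, changes only by a strictly proper error when [M] is replaced by [N], so it
    stays invertible. *)
Lemma rank_approximation_gt m n (M N : 'M[ratfun F]_(m, n)) p c i :
  invariant_orders_at_infty M p -> (i < size p)%N -> p`_i < c ->
  proper_mx (s ^ c *: (M - N)) -> (i < \rank N)%N.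
Proof.
case=> rp sp [B1 [B2 [/biproper_inv [u1 b1 _] /biproper_inv [u2 b2 _] e]]] ip pc MN.
have pm : (size p <= m)%N by rewrite rp rank_leq_row.
have pn : (size p <= n)%N by rewrite rp rank_leq_col.
pose L := dmx i.+1 m (fun j => s ^ p`_j); pose P := dmx n i.+1 (fun=> 1 : ratfun F).
have LDP : L *m (B1 *m M *m B2) *m P = 1%:M.
  rewrite e infty_diag_dmx !dmx_mul; apply: dmx_id => j ji.
  have jp : (j < size p)%N by exact: leq_trans ji ip.
  by rewrite /order_entry jp (leq_trans jp pm) (leq_trans jp pn) mulr1 -ratvar_expD subrr expr0z.
pose E := L *m (B1 *m (M - N) *m B2) *m P.
have PE : proper_mx (s *: E).
  (* The power [s ^ (1 - c)] goes to [L], whose entries become [s ^ (1 - c + p_j)]; the exponent is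
     at most 0 because [p_j <= p_i < c] are integers. *)
  have -> : s *: E = (s ^ (1 - c) *: L) *m (B1 *m (s ^ c *: (M - N)) *m B2) *m P.
    rewrite -!scalemxAr -!scalemxAl -scalemxAr -!scalemxAl scalerA -ratvar_expD.
    by rewrite subrK expr1z.
  apply: proper_mxM; last by apply: proper_dmx => *; exact: proper1.
  apply: proper_mxM; last exact: proper_mxM (proper_mxM (proj1 b1) MN) (proj1 b2).
  rewrite dmx_scale; apply: proper_dmx => j ji jm; rewrite -ratvar_expD.
  apply: proper_ratvar_exp.
  have : p`_j <= p`_i.
    by apply: (sorted_leq_nth le_trans lexx 0 sp); rewrite ?inE //; exact: leq_trans ji ip.
  lia.
have := det_perturbation_neq0 PE.
have -> : 1%:M - E = L *m (B1 *m N *m B2) *m P.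
  by rewrite -LDP -mulmxBl -mulmxBr -mulmxBl -mulmxBr subKr.
rewrite -unitfE -unitmxE => /mxrank_unit rk; rewrite -[leqLHS]rk.
rewrite (leq_trans (mxrankM_maxl _ _)) // (leq_trans (mxrankM_maxr _ _)) //.
by rewrite (leq_trans (mxrankM_maxl _ _)) // mxrankM_maxr.
Qed.

(** Each inequality is proved by contradiction, playing a truncation of one matrix against the rank
    lower bound for the other. Indices are 0-based. *)
Lemma interlacing_of_col_mx m n z (R : 'M[ratfun F]_(m, n)) (W : 'M_(z, n)) p q i :
  invariant_orders_at_infty R p -> invariant_orders_at_infty (col_mx R W) q ->
  (i < size p)%N ->
  q`_i <= p`_i /\ ((i + z < size q)%N -> p`_i <= q`_(i + z)).
Proof.
move=> hp hq ip; split.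
  have iq : (i < size q)%N.
    case: (hp) (hq) => rp _ _ [-> _ _]; apply: leq_trans ip _; rewrite rp.
    have e : R = usubmx 1%:M *m col_mx R W by rewrite mul_usub_mx mul1mx col_mxKu.
    by rewrite {1}e mxrankM_maxr.
  rewrite leNgt; apply/negP => pq.
  have [N rN PN] := low_rank_approximation hq iq.
  have PNu : proper_mx (s ^ q`_i *: (R - usubmx N)).
    by rewrite -(col_mxKu R W) -linearB -linearZ => j k; rewrite mxE; exact: PN.
  have := rank_approximation_gt hp ip pq PNu; rewrite ltnNge => /negP; apply.
  apply: leq_trans rN; rewrite -[N in usubmx N]mul1mx -mul_usub_mx; exact: mxrankM_maxr.
move=> izq; rewrite leNgt; apply/negP => qp.
have [N rN PN] := low_rank_approximation hp ip.
(* Stacking [W] itself under [N] adds no error and at most [z] to the rank. *)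
have PN' : proper_mx (s ^ p`_i *: (col_mx R W - col_mx N W)).
  rewrite opp_col_mx add_col_mx subrr => j k; rewrite mxE.
  case: (split_ordP j) => j' ->; first by rewrite col_mxEu; have := PN j' k; rewrite mxE.
  by rewrite col_mxEd mxE mulr0; exact: proper0.
have := rank_approximation_gt hq izq qp PN'; rewrite ltnNge => /negP; apply.
rewrite -addsmxE.
by apply: leq_trans (mxrank_adds_leqif _ _) _; rewrite leq_add // rank_leq_row.
Qed.


(* For z > 0 take Y = I + sum_i s^(p_i - q_(i+z)) E_(i, i+z), so that row i of
   D_p Y is s^(-p_i) e_i + s^(-q_(i+z)) e_(i+z).  Together with the first z rows
   of D_q these rows are U D_q, where U is, up to a permutation of rows, the lower
   unitriangular matrix I + sum_j s^(q_j - p_j) E_(j+z, j). *)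
Lemma interlaced_extension m n z p q :
  (size p <= m)%N -> (size q <= n)%N -> (size p <= size q <= size p + z)%N ->
  (forall i, (i < size p)%N ->
     q`_i <= p`_i /\ ((i + z < size q)%N -> p`_i <= q`_(i + z))) ->
  exists (W : 'M_(z, n)) (B1 : 'M_(m + z)) (B2 : 'M_n),
    [/\ biproper B1, biproper B2 &
        B1 *m col_mx (infty_diag_mx F m n p) W *m B2 = infty_diag_mx F (m + z) n q].
Proof.
move=> pm qn /andP[pq qpz] pqi.
(* For [z = 0] the extra entries of [Y] and [L] would fall on the diagonal; here the inequalities
   force [p = q] instead. *)
have [z0|z_gt0] := posnP z.
  have <- : p = q.
    apply: (@eq_from_nth int 0) => [|i ip]; first lia.
    have [qp] := pqi i ip; rewrite z0 addn0 => pq'; apply: le_anti.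
    by rewrite qp pq' // (leq_trans ip).
  exists 0, 1%:M, 1%:M; split; try exact: biproper_mx1.
  rewrite mulmx1 mul1mx; apply/matrixP => i j; case: (split_ordP i) => k ->.
    by rewrite col_mxEu !mxE.
  by case: k => k kz; exfalso; lia.
pose y (i j : nat) : ratfun F := (i == j)%:R +
  (if [&& j == (i + z)%N, (i < size p)%N & (j < size q)%N]
   then s ^ (p`_i - q`_j) else 0).
pose l (k j : nat) : ratfun F := (k == j)%:R +
  (if (k == (j + z)%N) && (j < size p)%N then s ^ (q`_j - p`_j) else 0).
pose u i := if (i < m)%N then l (z + i)%N else l (i - m)%N.
pose Y := \matrix_(i < n, j < n) y i j.
pose L := \matrix_(i < m + z, j < m + z) l i j.
pose U := \matrix_(i < m + z, j < m + z) u i j.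
have Pbool (b : bool) : proper (b%:R : ratfun F).
  by case: b; [exact: proper1 | exact: proper0].
have Pl i j : proper (l i j).
  apply: properD (Pbool _) _; case: ifP => [/andP[_ jp]|_]; last exact: proper0.
  by apply: proper_ratvar_exp; rewrite subr_le0; case: (pqi j jp).
have bY : biproper Y.
  apply: (@biproper_det _ _ _ false).
    move=> i j; rewrite mxE; apply: properD (Pbool _) _.
    case: ifP => [/and3P[/eqP -> ip jq]|_]; last exact: proper0.
    by apply: proper_ratvar_exp; rewrite subr_le0; case: (pqi i ip) => _; apply.
  rewrite -det_tr det_trig; last first.
    by apply/is_trig_mxP => i j ij; rewrite !mxE /y gtn_eqF // (ltn_eqF (ltn_addr z ij)) add0r.
  by apply: big1 => i _; rewrite !mxE /y eqxx -[X in X == _]addn0 eqn_add2l eq_sym gtn_eqF // addr0.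
have dL : \det L = 1.
  rewrite det_trig; last first.
    by apply/is_trig_mxP => i j ij; rewrite !mxE /l ltn_eqF // (ltn_eqF (ltn_addr z ij)) add0r.
  by apply: big1 => i _; rewrite !mxE /l eqxx -[X in X == _]addn0 eqn_add2l eq_sym gtn_eqF // addr0.
have bU : biproper U.
  (* The rows of [U] are those of [L] shifted cyclically by [z]: the first [z] rows of [L] come
     last, to match the block [W]. *)
  have sP (i : 'I_(m + z)) : ((if (i < m)%N then z + i else i - m) < m + z)%N.
    by have := ltn_ord i; case: ifP; lia.
  have sI : injective (fun i : 'I_(m + z) => Ordinal (sP i)).
    move=> i j /(congr1 val) /=; have := ltn_ord i; have := ltn_ord j.
    by move=> ? ? e; apply: val_inj => /=; move: e; case: ifP; case: ifP; lia.
  have -> : U = row_perm (perm sI) L.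
    by apply/matrixP => i j; rewrite !mxE permE /u /=; case: ifP.
  apply: (@biproper_det _ _ _ (perm sI)).
    by move=> i j; rewrite !mxE.
  by rewrite row_permE det_mulmx dL mulr1 det_perm.
have [uU _ bU'] := biproper_inv bU; have [uY _ _] := biproper_inv bY.
(* This [W] is chosen so that [W *m Y] is the first [z] rows of the target diagonal matrix. *)
exists (dmx z n (order_entry q) *m invmx Y), (invmx U), Y; split=> //.
suff e : col_mx (dmx m n (order_entry p) *m Y) (dmx z n (order_entry q))
         = U *m dmx (m + z) n (order_entry q).
  by rewrite !infty_diag_dmx -mulmxA mul_col_mx (mulmxKV uY) e (mulKmx uU).
rewrite mul_dmx mul_mx_dmx; apply/matrixP => i j; case: (split_ordP i) => k ->.
  rewrite col_mxEu !mxE /u /= ltn_ord /l /y /order_entry (addnC z k) eqn_add2r.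
  have := ltn_ord k; have := ltn_ord j.
  move: (nat_of_ord k) (nat_of_ord j) => {}k {}j jn km.
  have kkz : (k == (k + z)%N) = false by apply: ltn_eqF; lia.
  (* In an upper row [k], only columns [k] and [k + z] can be nonzero on either side. *)
  case: (eqVneq k j) jn => [<-|kj] jn.
    rewrite [(k + z)%N == k]eq_sym kkz jn addr0 add0r mulr1 ltn_addr //.
    case: ifP => kp; last by rewrite mul0r.
    by rewrite (leq_trans kp pq) -ratvar_expD addrAC subrr add0r.
  rewrite [j == _]eq_sym add0r addr0; case: eqP => [e|_]; last first.
    by rewrite mulr0 mul0r !if_same.
  rewrite -e ltn_add2r km mul1r; case: (ltnP (k + z) (size q)) => kq; last first.
    by rewrite andbF mulr0 if_same.
  (* The bound [size q <= size p + z] enters here: without it row [k] of the left side could vanish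
     while [q] still has a term at [k + z]. *)
  have kp : (k < size p)%N by lia.
  have -> : (k < n)%N by lia.
  by rewrite kp -ratvar_expD addrA addNr add0r.
rewrite col_mxEd !mxE /u /= [(m + k < m)%N]ltnNge leq_addr /= addKn /l /order_entry.
(* As [k < z], the lower rows of [U] are rows of the identity. *)
rewrite (_ : (k == (j + z)%N :> nat) = false); last first.
  by apply: ltn_eqF; rewrite ltn_addl.
rewrite addr0; case: eqP => [<-|_]; last by rewrite mul0r if_same.
by rewrite mul1r ltn_addl.
Qed.

(** The diagonal case transfers: [B1] is bordered by an identity so as to act on the rows of [R]
    alone, and the new rows are multiplied by the inverse of [B2] to undo the column change. *)
Lemma exists_interlaced_col_mx m n z (R : 'M[ratfun F]_(m, n)) p q :
  invariant_orders_at_infty R p -> sorted <=%R q ->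
  (size q <= n)%N -> (size p <= size q <= size p + z)%N ->
  (forall i, (i < size p)%N ->
     q`_i <= p`_i /\ ((i + z < size q)%N -> p`_i <= q`_(i + z))) ->
  exists W : 'M_(z, n), invariant_orders_at_infty (col_mx R W) q.
Proof.
case=> rp _ [B1 [B2 [bB1 bB2 e]]] sq qn pqz pqi.
have pm : (size p <= m)%N by rewrite rp rank_leq_row.
have [W [C1 [C2 [bC1 bC2 eC]]]] := interlaced_extension pm qn pqz pqi.
have [uB2 _ _] := biproper_inv bB2.
pose D1 := C1 *m block_mx B1 0 0 (1%:M : 'M_z); pose D2 := B2 *m C2.
have bD1 : biproper D1 by apply: biproper_mxM bC1 _; exact: biproper_block.
have bD2 : biproper D2 by exact: biproper_mxM.
have eD : D1 *m col_mx R (W *m invmx B2) *m D2 = infty_diag_mx F (m + z) n q.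
  rewrite -eC /D1 /D2 mulmxA -(mulmxA C1) -(mulmxA C1); congr (_ *m _ *m _).
  by rewrite mul_block_col !mul0mx addr0 add0r mul1mx mul_col_mx (mulmxKV uB2) e.
move: D1 D2 bD1 bD2 eD => D1 D2 bD1 bD2 eD.
exists (W *m invmx B2); split=> //; last by exists D1, D2.
have [[uD1 _ _] [uD2 _ _]] := (biproper_inv bD1, biproper_inv bD2).
have /andP[_ qpz] := pqz.
rewrite -(@rank_infty_diag (m + z) n q) //; last first.
  by rewrite (leq_trans qpz) // leq_add2r.
by rewrite -eD (mxrank_mul_unit _ uD1 uD2).
Qed.

End InvariantOrders.

(** * From extended 1-based sequences to the final equivalence *)

Lemma ext_nth_interlacing r k z (p : r.-tuple int) (q : k.-tuple int) : (r <= k)%N ->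
  (forall i : nat, (1 <= i <= r)%N ->
     (ext_nth q i <= ext_nth p i <= ext_nth q (i + z))%E) <->
  (forall i : nat, (i < r)%N ->
     q`_i <= p`_i /\ ((i + z < k)%N -> p`_i <= q`_(i + z))).
Proof.
move=> rk.
have E i : (i < r)%N ->
    (ext_nth q i.+1 <= ext_nth p i.+1 <= ext_nth q (i.+1 + z))%E =
    (q`_i <= p`_i) && ((i + z < k)%N ==> (p`_i <= q`_(i + z))).
  (* The value [+oo] can occur only in the upper bound, where it turns into the guard
     [i + z < k]. *)
  move=> ir; rewrite /ext_nth /= !size_tuple ir (leq_trans ir rk) lee_fin.
  by congr (_ && _); rewrite addSn; case: ifP => _ /=; rewrite ?lee_fin ?leey.
split=> H i.
  by move=> ir; have := H i.+1; rewrite E // => /(_ ir) /andP[-> /implyP].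
case: i => // i ir; have [qp pq] := H i ir; rewrite E // qp; exact/implyP.
Qed.

Theorem theorem4p7 (F : fieldType) (m n r z x : nat)
    (R : 'M[ratfun F]_(m, n)) (p : r.-tuple int) (q : (r + x).-tuple int)
    (hr : \rank R = r)
    (hp : invariant_orders_at_infty R p)
    (hx : (x <= minn z (n - r))%N)
    (hq : sorted <=%R q) :
  (exists W : 'M[ratfun F]_(z, n),
      \rank (col_mx R W) = (r + x)%N /\
      invariant_orders_at_infty (col_mx R W) q) <->
  (forall i : nat, (1 <= i <= r)%N ->
      (ext_nth q i <= ext_nth p i <= ext_nth q (i + z))%E).
Proof.
rewrite (ext_nth_interlacing z p q (leq_addr x r)); split=> [[W [_ hqW]] i ir|H].
  by have := interlacing_of_col_mx hp hqW; rewrite !size_tuple; apply.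
have rn : (r <= n)%N by rewrite -hr rank_leq_col.
have [W hW] : exists W : 'M_(z, n), invariant_orders_at_infty (col_mx R W) q.
  (* The bound [x <= n - r] makes [q] fit in [n] columns, and [x <= z] gives
     [size q <= size p + z]. *)
  move: hx; rewrite leq_min => /andP[xz xnr].
  apply: exists_interlaced_col_mx hp hq _ _ _; rewrite !size_tuple //.
    by rewrite -leq_subRL.
  by rewrite leq_addr leq_add2l.
by exists W; split=> //; case: hW => <-; rewrite size_tuple.
Qed.
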